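(* Let $F:\mathbb{R}^n\to\mathbb{R}$ be differentiable with locally Lipschitz continuous gradient $\dot F$, and let the algorithm described in the context be applied to $F$ from an arbitrary $\theta_0\in\mathbb{R}^n$. Then for any fixed $T\in\mathbb{N}$, $F(\theta_T)\le F(\theta_0)$. Moreover, if $\dot F(\theta_0)\ne0$, then there exists $T^*\in\mathbb{N}$ such that $F(\theta_t)<F(\theta_0)$ for all $t\ge T^*$.
   Context: Algorithm. $F:\mathbb{R}^n\to\mathbb{R}$ is differentiable with gradient $\dot F$. Inputs: $\theta_0\in\mathbb{R}^n$, $\rho\in(0,1)$, $\overline\delta\in(0,\infty)$, $\delta_0\in(0,\overline\delta]$. Set $\tau_{\mathrm{low}}^0=\|\dot F(\theta_0)\|_2/\sqrt2$ and $\tau_{\mathrm{upp}}^0=\sqrt{10}\,\|\dot F(\theta_0)\|_2$. For outer iterations $k=0,1,2,\ldots$: if $\dot F(\theta_k)=0$, terminate. Otherwise set $\psi_0^k=\theta_k$, $j=0$, and run the inner loop: (i) Compute $\hat L_j^k$: $\hat L_0^0=1$; $\hat L_0^k=\hat L_{j_{k-1}}^{k-1}$ for $k>0$; and for $j>0$, with $q=\|\dot F(\psi_j^k)-\dot F(\psi_{j-1}^k)\|_2/\|\psi_j^k-\psi_{j-1}^k\|_2$, set $\hat L_j^k=q$ if $k=0$ or $\theta_k\ne\theta_{k-1}$, and $\hat L_j^k=\max(q,\hat L_{j-1}^k)$ if $k>0$ and $\theta_k=\theta_{k-1}$. (ii) With $g=\|\dot F(\psi_j^k)\|_2$, set $C_{j,1}^k=g^3+\tfrac12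 g^2\hat L_j^k+10^{-16}$, $C_{j,2}^k=g+\tfrac12\hat L_j^k+10^{-16}$, and $\alpha_j^k=\min\big((\tau_{\mathrm{low}}^k)^2/C_{j,1}^k,\ 1/C_{j,2}^k\big)+10^{-16}$. (iii) Check whether a triggering event occurs: $\|\psi_j^k-\theta_k\|_2>10$, or $\|\dot F(\psi_j^k)\|_2\notin(\tau_{\mathrm{low}}^k,\tau_{\mathrm{upp}}^k)$, or $j=100$. If none occurs, set $\psi_{j+1}^k=\psi_j^k-\delta_k\alpha_j^k\dot F(\psi_j^k)$, replace $j$ by $j+1$, and return to (i). If one occurs, set $j_k=j$ (one has $0<j_k\le100$), exit the inner loop, and update as follows: - (reject) if $F(\psi_{j_k}^k)\ge F(\theta_k)-\rho\delta_k\alpha_0^k\|\dot F(\theta_k)\|_2^2$: $\theta_{k+1}=\theta_k$, $\delta_{k+1}=\tfrac12\delta_k$, thresholds unchanged; - (accept) else if $\|\dot F(\psi_{j_k}^k)\|_2\le\tau_{\mathrm{low}}^k$: $\theta_{k+1}=\psi_{j_k}^k$, $\delta_{k+1}=\delta_k$, $\tau_{\mathrm{low}}^{k+1}=\|\dot F(\theta_{k+1})\|_2/\sqrt2$, $\tau_{\mathrm{upp}}^{k+1}=\sqrt{20}\,\tau_{\mathrm{low}}^{k+1}$; - (accept) else if $\|\dot F(\psi_{j_k}^k)\|_2\ge\tau_{\mathrm{upp}}^k$: $\theta_{k+1}=\psi_{j_k}^k$, $\delta_{k+1}=\min\{1.5\,\delta_k,\overline\delta\}$, $\tau_{\mathrm{low}}^{k+1}=\|\dot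 F(\theta_{k+1})\|_2/\sqrt2$, $\tau_{\mathrm{upp}}^{k+1}=\sqrt{20}\,\tau_{\mathrm{low}}^{k+1}$; - (accept) else: $\theta_{k+1}=\psi_{j_k}^k$, $\delta_{k+1}=\min\{1.5\,\delta_k,\overline\delta\}$, thresholds unchanged. If the algorithm terminates at outer iteration $K$, put $\theta_k=\theta_K$ and $\delta_k=\delta_K$ for $k\ge K$. A function is locally Lipschitz continuous if every point has an open ball around it on which the function is Lipschitz continuous. *)

(* Defs.v *)
From HB Require Import structures.
From mathcomp Require Import all_boot all_order all_algebra.
From mathcomp Require Import all_classical all_reals all_analysis.
Import Order.TTheory GRing.Theory Num.Theory.
Import numFieldNormedType.Exports.

Set Implicit Arguments.
Unset Strict Implicit.
Unset Printing Implicit Defensive.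

Local Open Scope ring_scope.

(* The library norm on ['rV[R]_n] is the max norm, hence this one. *)
Definition norm2 (R : realType) (n : nat) (x : 'rV[R]_n) : R :=
  Num.sqrt (\sum_i x ord0 i ^+ 2).

Definition grad (R : realType) (n : nat) (F : 'rV[R]_n -> R) (x : 'rV[R]_n) :
    'rV[R]_n :=
  \row_i 'D_(delta_mx ord0 i) F x.

Definition locally_lipschitz (R : realType) (n : nat)
    (f : 'rV[R]_n -> 'rV[R]_n) : Prop :=
  forall x, exists r L : R, 0 < r /\
    forall y z, norm2 (y - x) < r -> norm2 (z - x) < r ->
      norm2 (f y - f z) <= L * norm2 (y - z).

(* The data of outer iteration k.  [prev_theta] is [None] for k = 0 and
   [Some theta_{k-1}] for k > 0; [lip0] is the value of Lhat at j = 0. *)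
Record state (R : realType) (n : nat) := State {
  theta : 'rV[R]_n;
  prev_theta : option 'rV[R]_n;
  delta : R;
  tau_low : R;
  tau_upp : R;
  lip0 : R
}.

Definition init (R : realType) (n : nat) (F : 'rV[R]_n -> R) (delta0 : R)
    (theta0 : 'rV[R]_n) : state R n :=
  let g := norm2 (grad F theta0) in
  State theta0 None delta0 (g / Num.sqrt 2) (Num.sqrt 10 * g) 1.

Definition alpha (R : realType) (n : nat) (F : 'rV[R]_n -> R) (s : state R n)
    (psi : 'rV[R]_n) (L : R) : R :=
  let g := norm2 (grad F psi) in
  let C1 := g ^+ 3 + 2^-1 * g ^+ 2 * L + 10 ^- 16 in
  let C2 := g + 2^-1 * L + 10 ^- 16 in
  Num.min (tau_low s ^+ 2 / C1) (1 / C2) + 10 ^- 16.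

(* The pair (psi_j, Lhat_j).  The recursion ignores the triggering events;
   only the terms with j <= [jstop s] below are visited by the algorithm. *)
Fixpoint inner (R : realType) (n : nat) (F : 'rV[R]_n -> R) (s : state R n)
    (j : nat) : 'rV[R]_n * R :=
  if j is i.+1 then
    let: (psi, L) := inner F s i in
    let psi' := psi - (delta s * alpha F s psi L) *: grad F psi in
    let q := norm2 (grad F psi' - grad F psi) / norm2 (psi' - psi) in
    (psi', if prev_theta s == Some (theta s) then Num.max q L else q)
  else (theta s, lip0 s).

Definition trigger (R : realType) (n : nat) (F : 'rV[R]_n -> R) (s : state R n)
    (j : nat) : bool :=
  let psi := (inner F s j).1 in
  [|| 10 < norm2 (psi - theta s),
      ~~ (tau_low s < norm2 (grad F psi) < tau_upp s)
    | j == 100%N].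

Lemma trigger_ex (R : realType) (n : nat) (F : 'rV[R]_n -> R) (s : state R n) :
  exists j, trigger F s j.
Proof. by exists 100%N; rewrite /trigger eqxx !orbT. Qed.

Definition jstop (R : realType) (n : nat) (F : 'rV[R]_n -> R) (s : state R n) :
    nat :=
  ex_minn (trigger_ex F s).

(* One outer iteration; a state with zero gradient is left unchanged, which
   renders the convention theta_k = theta_K, delta_k = delta_K for k >= K. *)
Definition step (R : realType) (n : nat) (F : 'rV[R]_n -> R) (rho dbar : R)
    (s : state R n) : state R n :=
  let th := theta s in
  if grad F th == 0 then s else
  let: (psi, L) := inner F s (jstop F s) in
  let g := norm2 (grad F psi) in
  let low := g / Num.sqrt 2 in
  if F psi >= F th - rho * delta s * alpha F s th (lip0 s)
                       * norm2 (grad F th) ^+ 2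
  then State th (Some th) (2^-1 * delta s) (tau_low s) (tau_upp s) L
  else if g <= tau_low s
  then State psi (Some th) (delta s) low (Num.sqrt 20 * low) L
  else if g >= tau_upp s
  then State psi (Some th) (Num.min (3 / 2 * delta s) dbar)
         low (Num.sqrt 20 * low) L
  else State psi (Some th) (Num.min (3 / 2 * delta s) dbar)
         (tau_low s) (tau_upp s) L.

Definition iterate (R : realType) (n : nat) (F : 'rV[R]_n -> R)
    (rho dbar delta0 : R) (theta0 : 'rV[R]_n) (k : nat) : 'rV[R]_n :=
  theta (iter k (step F rho dbar) (init F delta0 theta0)).

(* Main.v *)
Require Import Defs.
From HB Require Import structures.
From mathcomp Require Import all_boot all_order all_algebra.
From mathcomp Require Import all_classical all_reals all_analysis.
From mathcomp Require Import ring lra.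
Set Implicit Arguments.
Unset Strict Implicit.
Unset Printing Implicit Defensive.

Import Order.TTheory GRing.Theory Num.Theory.
Import numFieldNormedType.Exports.
Local Open Scope ring_scope.

(* An accepted iterate decreases F strictly, so it suffices that theta_0 cannot
   be rejected forever.  Each rejection halves delta and leaves the thresholds
   unchanged.  While no event is triggered, the inner step lengths alpha are at
   most 1/tau_low + 1 and the gradients at most tau_upp; hence for small delta
   the at most 100 inner iterates stay in a ball on which the gradient is
   Lipschitz.  There every inner step decreases F, and the first one already
   decreases it by more than the acceptance test demands. *)

(** * Euclidean inner product and norm on row vectors *)

Definition dot {R : realType} {n : nat} (u v : 'rV[R]_n) : R :=
  \sum_i u ord0 i * v ord0 i.

Section EuclideanNorm.
Context {R : realType} {n : nat}.
Implicit Types (u v x y : 'rV[R]_n) (a : R).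

Lemma sqr_norm2 u : norm2 u ^+ 2 = dot u u.
Proof.
rewrite sqr_sqrtr; last by apply: sumr_ge0 => i _; exact: sqr_ge0.
by apply: eq_bigr => i _; rewrite expr2.
Qed.

Lemma norm2_ge0 u : 0 <= norm2 u. Proof. exact: sqrtr_ge0. Qed.

Lemma norm2_eq0 u : (norm2 u == 0) = (u == 0).
Proof.
apply/idP/eqP => [/eqP nu0|->]; last first.
  by rewrite /norm2 big1 ?sqrtr0// => i _; rewrite mxE expr0n.
have /eqP : dot u u = 0 by rewrite -sqr_norm2 nu0 expr0n.
rewrite psumr_eq0 => [/allP u0|i _]; last by rewrite -expr2 sqr_ge0.
apply/rowP => i; rewrite mxE; apply/eqP.
by have := u0 i (mem_index_enum _); rewrite mulf_eq0 orbb.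
Qed.

Lemma norm2_0 : norm2 (0 : 'rV[R]_n) = 0.
Proof. by apply/eqP; rewrite norm2_eq0. Qed.

Lemma norm2_gt0 u : (0 < norm2 u) = (u != 0).
Proof. by rewrite lt0r norm2_eq0 norm2_ge0 andbT. Qed.

Lemma norm2Z a u : norm2 (a *: u) = `|a| * norm2 u.
Proof.
rewrite /norm2 -sqrtr_sqr -sqrtrM ?sqr_ge0// mulr_sumr.
by congr Num.sqrt; apply: eq_bigr => i _; rewrite mxE exprMn.
Qed.

Lemma norm2N u : norm2 (- u) = norm2 u.
Proof. by rewrite -scaleN1r norm2Z normrN1 mul1r. Qed.

Lemma dotZr a u v : dot u (a *: v) = a * dot u v.
Proof. by rewrite mulr_sumr; apply: eq_bigr => i _; rewrite mxE mulrCA. Qed.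

Lemma dotBl u v x : dot (u - v) x = dot u x - dot v x.
Proof. by rewrite -sumrB; apply: eq_bigr => i _; rewrite !mxE mulrBl. Qed.

(** Cauchy-Schwarz: the squared norm of [b u - a v] expands to [2ab(ab - dot u v)]. Zero vectors are
    split off so that the factor [2ab] can be cancelled. *)
Lemma dot_le_norm2 u v : dot u v <= norm2 u * norm2 v.
Proof.
have [->|u0] := eqVneq u 0.
  by rewrite /dot big1 ?mulr_ge0 ?norm2_ge0// => i _; rewrite mxE mul0r.
have [->|v0] := eqVneq v 0.
  by rewrite /dot big1 ?mulr_ge0 ?norm2_ge0// => i _; rewrite mxE mulr0.
rewrite -norm2_gt0 in u0; rewrite -norm2_gt0 in v0.
set a := norm2 u; set b := norm2 v.
have : 0 <= \sum_i (b * u ord0 i - a * v ord0 i) ^+ 2.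
  by apply: sumr_ge0 => i _; exact: sqr_ge0.
have -> : \sum_i (b * u ord0 i - a * v ord0 i) ^+ 2
    = b ^+ 2 * dot u u - 2 * a * b * dot u v + a ^+ 2 * dot v v.
  rewrite !mulr_sumr -sumrB -big_split; apply: eq_bigr => i _ /=; ring.
rewrite -!sqr_norm2 -/a -/b.
have -> : b ^+ 2 * a ^+ 2 - 2 * a * b * dot u v + a ^+ 2 * b ^+ 2
  = 2 * (a * b) * (a * b - dot u v) by ring.
by rewrite pmulr_rge0 ?subr_ge0// mulr_gt0// mulr_gt0.
Qed.

Lemma norm2D u v : norm2 (u + v) <= norm2 u + norm2 v.
Proof.
rewrite -(ler_pXn2r (ltn0Sn 1)) ?nnegrE ?addr_ge0 ?norm2_ge0//.
rewrite sqr_norm2 sqrrD !sqr_norm2.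
have -> : dot (u + v) (u + v) = dot u u + dot u v *+ 2 + dot v v.
  rewrite /dot -sumrMnl -!big_split; apply: eq_bigr => i _ /=.
  by rewrite !mxE; ring.
by rewrite lerD2r lerD2l lerMn2r/= dot_le_norm2.
Qed.

End EuclideanNorm.

(** * Mean value theorem along lines and decrease under one gradient step *)

Section Descent.
Context {R : realType} {n : nat} {F : 'rV[R]_n -> R}.
Hypothesis F_diff : forall x, differentiable F x.
Implicit Types (x h : 'rV[R]_n) (a l : R).

Lemma derive_grad x h : 'D_h F x = dot (grad F x) h.
Proof.
rewrite deriveE// {1}(row_sum_delta h) linear_sum.
apply: eq_bigr => i _; rewrite linearZ /grad mxE -deriveE//.
by rewrite mulrC.
Qed.

Lemma is_derive_line x h (t : R) :
  is_derive t 1 (fun s : R => F (x + s *: h)) (dot (grad F (x + t *: h)) h).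
Proof.
(* The difference quotient of [F] at [x + t *: h] in direction [h] is that of the restriction to the
   line at [t] in direction [1]. *)
have E : (fun s : R => s^-1 *: (F (s *: h + (x + t *: h)) - F (x + t *: h)))
  = (fun s : R => s^-1 *: (F (x + (s *: (1 : R) + t) *: h) - F (x + t *: h))).
  apply/funext => s; congr (_ *: (F _ - _)).
  by rewrite -[s *: 1]/(s * 1) mulr1 scalerDl addrCA.
rewrite -derive_grad; split.
  have : derivable F (x + t *: h) h by exact: diff_derivable.
  by rewrite /derivable E.
by rewrite /derive E.
Qed.

Lemma mean_value x h : exists2 t : R, 0 <= t <= 1 &
  F (x + h) - F x = dot (grad F (x + t *: h)) h.
Proof.
have [||t t01 E] := @MVT_segment R (fun s : R => F (x + s *: h))
    (fun t => dot (grad F (x + t *: h)) h) 0 1 ler01.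
- by move=> t _; exact: is_derive_line.
- apply: continuous_subspaceT => t.
  apply: differentiable_continuous; apply/derivable1_diffP.
  exact: (@ex_derive _ _ _ _ _ _ _ (is_derive_line x h t)).
exists t; first by move: t01; rewrite in_itv.
by move: E; rewrite subr0 mulr1 scale1r scale0r addr0.
Qed.

(* The constant is [l * a] rather than the usual [l * a / 2], as the mean value
   theorem is applied without integrating the gradient along the segment. *)
Lemma descent x a l : 0 <= a ->
  (forall t, 0 <= t <= 1 ->
     norm2 (grad F (x - (t * a) *: grad F x) - grad F x)
       <= l * norm2 ((t * a) *: grad F x)) -> 0 <= l ->
  F (x - a *: grad F x) <= F x - a * (1 - l * a) * norm2 (grad F x) ^+ 2.
Proof.
move=> a0 lip l0; rewrite -scaleNr.
have [t t01] := mean_value x (- a *: grad F x).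
have /andP[t0 t1] := t01.
rewrite scalerA mulrN [- (t * a) *: _]scaleNr dotZr => E.
set g := grad F x in E lip *; set G := grad F _ in E.
have : - dot (G - g) g <= l * a * norm2 g ^+ 2.
  have -> : - dot (G - g) g = dot (g - G) g by rewrite !dotBl opprB.
  apply: le_trans (dot_le_norm2 _ _) _.
  rewrite expr2 mulrA ler_wpM2r ?norm2_ge0//.
  rewrite -norm2N opprB (le_trans (lip t t01))// norm2Z ger0_norm ?mulr_ge0//.
  by rewrite mulrA ler_wpM2r ?norm2_ge0// ler_wpM2l// ler_piMl.
rewrite dotBl -sqr_norm2 => H.
rewrite -lerBlDl E.
have := ler_wpM2l a0 H; lra.
Qed.

End Descent.

(** * Step lengths, inner loop and outer update *)

Section Algorithm.
Context {R : realType} {n : nat} {F : 'rV[R]_n -> R}.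
Implicit Types (s : state R n) (psi : 'rV[R]_n) (L : R).

(** The minimum is only nonnegative; the summand [10 ^- 16] outside it gives positivity. *)
Lemma alpha_gt0 s psi L : 0 <= L -> 0 < alpha F s psi L.
Proof.
move=> L0; rewrite ltr_wpDl ?invr_gt0 ?exprn_gt0// le_min.
by rewrite !divr_ge0 ?sqr_ge0 ?addr_ge0 ?mulr_ge0 ?exprn_ge0 ?invr_ge0
  ?norm2_ge0.
Qed.

(** Since [C2] dominates the gradient norm, [1 / C2] is at most [(tau_low s)^-1]. The bound does not
    depend on [L], which nothing controls from above. *)
Lemma alpha_le s psi L : 0 <= L -> 0 < tau_low s < norm2 (grad F psi) ->
  alpha F s psi L <= (tau_low s)^-1 + 1.
Proof.
move=> L0 /andP[low0 lowg].
rewrite lerD//; last by rewrite invf_le1 ?exprn_gt0// exprn_ege1// ler1n.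
rewrite ge_min; apply/orP; right; rewrite div1r lef_pV2 ?posrE//.
  rewrite (le_trans (ltW lowg))// -addrA lerDl.
  by rewrite addr_ge0 ?mulr_ge0// ?invr_ge0 ?exprn_ge0.
by rewrite ltr_wpDl ?invr_gt0 ?exprn_gt0// addr_ge0 ?norm2_ge0// mulr_ge0.
Qed.

Lemma innerS s j : (inner F s j.+1).1 = (inner F s j).1
  - (delta s * alpha F s (inner F s j).1 (inner F s j).2)
      *: grad F (inner F s j).1.
Proof. by rewrite /=; case: inner. Qed.

(** Holds even if two successive inner iterates coincide, as a quotient by [0] is [0]. *)
Lemma inner_lip_ge0 s j : 0 <= lip0 s -> 0 <= (inner F s j).2.
Proof.
move=> L0; elim: j => //= j; case: inner => psi L /= Lge0.
by case: ifP => _; rewrite ?le_max divr_ge0 ?norm2_ge0.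
Qed.

Lemma jstop_le s : (jstop F s <= 100)%N.
Proof.
by rewrite /jstop; case: ex_minnP => m _; apply; rewrite /trigger eqxx !orbT.
Qed.

Lemma trigger_jstop s j : (j < jstop F s)%N -> trigger F s j = false.
Proof.
rewrite /jstop; case: ex_minnP => m _ m_min jm.
by apply/negP => /m_min; rewrite leqNgt jm.
Qed.

(** At [j = 0] the displacement is zero, so no event can occur and a first inner step is taken. *)
Lemma jstop_gt0 s : tau_low s < norm2 (grad F (theta s)) < tau_upp s ->
  (0 < jstop F s)%N.
Proof.
move=> g_itv; rewrite /jstop; case: ex_minnP => -[|//].
by rewrite /trigger /= subrr g_itv norm2_0 ltrn0.
Qed.

(** The invariant of the outer loop that makes all inner step lengths positive. *)
Definition admissible s : Prop := 0 < delta s /\ 0 <= lip0 s.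

(** Negation of the rejection test in [step]. *)
Definition accepts (rho : R) s : bool :=
  F (inner F s (jstop F s)).1
    < F (theta s) - rho * delta s * alpha F s (theta s) (lip0 s)
                      * norm2 (grad F (theta s)) ^+ 2.

Lemma step_admissible (rho dbar : R) s : 0 < dbar -> admissible s ->
  admissible (step F rho dbar s).
Proof.
move=> dbar0 [d0 L0]; rewrite /step; case: ifP => // _.
have := inner_lip_ge0 (jstop F s) L0; case: inner => psi L /= Lge0.
by do 3?case: ifP => _; split; rewrite ?lt_min ?dbar0 ?mulr_gt0 ?invr_gt0.
Qed.

Lemma iter_step_admissible (rho dbar delta0 : R) (x : 'rV[R]_n) k :
  0 < dbar -> 0 < delta0 ->
  admissible (iter k (step F rho dbar) (init F delta0 x)).
Proof.
move=> dbar0 delta0_gt0.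
by elim: k => [|k]; [split => //=; exact: ler01|exact: step_admissible].
Qed.

Lemma step_reject (rho dbar : R) s : grad F (theta s) != 0 ->
  ~~ accepts rho s ->
  let s' := step F rho dbar s in
  [/\ theta s' = theta s, delta s' = 2^-1 * delta s,
      tau_low s' = tau_low s & tau_upp s' = tau_upp s].
Proof.
rewrite /step /accepts => /negPf->; case: inner => psi L /=.
by rewrite -leNgt => ->.
Qed.

Lemma step_accept (rho dbar : R) s : grad F (theta s) != 0 -> accepts rho s ->
  theta (step F rho dbar s) = (inner F s (jstop F s)).1.
Proof.
rewrite /step /accepts => /negPf->; case: inner => psi L /=.
by rewrite ltNge => /negPf->; do 2?case: ifP.
Qed.

Lemma step_accept_lt (rho dbar : R) s : 0 < rho -> admissible s ->
  grad F (theta s) != 0 -> accepts rho s ->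
  F (theta (step F rho dbar s)) < F (theta s).
Proof.
move=> rho0 [d0 L0] g0 acc; rewrite step_accept//; apply: lt_le_trans acc _.
rewrite gerBl mulr_ge0 ?sqr_ge0// mulr_ge0 ?(ltW (alpha_gt0 _ _ L0))//.
by rewrite mulr_ge0 ?ltW.
Qed.

Lemma step_le (rho dbar : R) s : 0 < rho -> admissible s ->
  F (theta (step F rho dbar s)) <= F (theta s).
Proof.
move=> rho0 adm; have [g0|g0] := eqVneq (grad F (theta s)) 0.
  by rewrite /step g0 eqxx.
have [acc|rej] := boolP (accepts rho s); first exact/ltW/step_accept_lt.
by have [->] := step_reject dbar g0 rej.
Qed.

(** * Acceptance for small [delta] and eventual decrease *)

Hypothesis F_diff : forall x, differentiable F x.

(** The bound [d] is chosen before the state and is independent of [lip0] and [prev_theta], so one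
    [d] serves a whole run of rejections. *)
Lemma accepts_small_delta (rho low upp : R) (x : 'rV[R]_n) :
  locally_lipschitz (grad F) -> 0 < rho -> rho < 1 ->
  0 < low < norm2 (grad F x) -> norm2 (grad F x) < upp ->
  exists2 d, 0 < d & forall s, theta s = x -> tau_low s = low ->
    tau_upp s = upp -> admissible s -> delta s < d -> accepts rho s.
Proof.
move=> lipF rho0 rho1 /andP[low0 lowg] gupp.
have [r [l0 [r0 lip_l0]]] := lipF x.
(* The given constant [l0] may be negative or zero; a positive one is needed as a divisor. *)
pose l := `|l0| + 1; have l_gt0 : 0 < l by rewrite ltr_wpDl.
have lip y z : norm2 (y - x) < r -> norm2 (z - x) < r ->
    norm2 (grad F y - grad F z) <= l * norm2 (y - z).
  move=> yr zr; rewrite (le_trans (lip_l0 _ _ yr zr))// ler_wpM2r ?norm2_ge0//.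
  by rewrite (le_trans (ler_norm _))// lerDl.
pose A := low^-1 + 1; have A0 : 0 < A by rewrite addr_gt0 ?invr_gt0.
have upp0 : 0 < upp by rewrite (lt_trans low0)// (lt_trans lowg).
(* Each inner step has norm at most [delta s * (A * upp)]. The first bound keeps 100 steps and one
   further segment within radius [r]; the second makes [1 - l * a] exceed [rho] for every step
   length [a]. *)
exists (Num.min (r / (101 * (A * upp))) ((1 - rho) / (l * A))).
  by rewrite lt_min !divr_gt0 ?mulr_gt0 ?subr_gt0.
move=> s sx slow supp [d0 L0]; rewrite lt_min !ltr_pdivlMr ?mulr_gt0//.
case/andP => dr drho.
have g_itv j : (j < jstop F s)%N ->
    low < norm2 (grad F (inner F s j).1) < upp.
  move=> /trigger_jstop/negbT; rewrite /trigger slow supp.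
  by rewrite !negb_or negbK => /and3P[].
have alphaA j : (j < jstop F s)%N ->
    alpha F s (inner F s j).1 (inner F s j).2 <= A.
  move=> jlt; have /andP[lowgj _] := g_itv _ jlt.
  by rewrite /A -slow alpha_le ?inner_lip_ge0// slow low0.
have step_norm j : (j < jstop F s)%N ->
    norm2 ((delta s * alpha F s (inner F s j).1 (inner F s j).2)
             *: grad F (inner F s j).1) <= delta s * (A * upp).
  move=> jlt; have /andP[_ guppj] := g_itv _ jlt.
  have al0 := alpha_gt0 s (inner F s j).1 (inner_lip_ge0 j L0).
  rewrite norm2Z ger0_norm ?mulr_ge0 ?(ltW d0) ?(ltW al0)//.
  rewrite -mulrA ler_wpM2l ?(ltW d0)//.
  by rewrite ler_pM ?norm2_ge0 ?alphaA ?ltW.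
have near j : (j <= jstop F s)%N ->
    norm2 ((inner F s j).1 - x) <= delta s * (A * upp) * j%:R.
  elim: j => [_|j IHj jlt].
    by rewrite /= sx subrr mulr0 norm2_0.
  rewrite innerS addrAC -natr1 [leRHS]mulrDr mulr1 (le_trans (norm2D _ _))//.
  by rewrite lerD ?IHj ?norm2N ?step_norm// ltnW.
have decr j : (j < jstop F s)%N ->
    F (inner F s j.+1).1 < F (inner F s j).1
      - rho * delta s * alpha F s (inner F s j).1 (inner F s j).2
          * norm2 (grad F (inner F s j).1) ^+ 2.
  move=> jlt; have := alpha_gt0 s (inner F s j).1 (inner_lip_ge0 j L0).
  have := step_norm _ jlt; have := alphaA _ jlt.
  have /andP[lowgj _] := g_itv _ jlt.
  have := near _ (ltnW jlt); rewrite innerS.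
  set psi := (inner F s j).1; set al := alpha _ _ _ _.
  move=> psi_near alA al_norm al0.
  (* The whole segment to the next iterate must lie in the ball for [descent]; [t = 0] covers [psi]
     itself. *)
  have in_ball t : 0 <= t <= 1 ->
      norm2 (psi - (t * (delta s * al)) *: grad F psi - x) < r.
    move=> /andP[t0 t1]; apply: le_lt_trans dr.
    rewrite addrAC (le_trans (norm2D _ _))// norm2N -scalerA norm2Z ger0_norm//.
    have -> : 101 = 100%:R + 1 :> R by ring.
    rewrite [leRHS]mulrCA [leRHS]mulrDl mul1r lerD//.
      rewrite (le_trans psi_near)// [leRHS]mulrC.
      rewrite ler_wpM2l ?mulr_ge0 ?ler_nat ?ltW//.
      by rewrite (leq_trans (ltnW jlt)) ?jstop_le.
    by rewrite (le_trans _ al_norm)// ler_piMl ?norm2_ge0.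
  have al_lip : (delta s * al) * l < 1 - rho.
    rewrite (le_lt_trans _ drho)// -mulrA ler_wpM2l ?(ltW d0)//.
    by rewrite mulrC ler_wpM2l ?(ltW l_gt0).
  apply: (@le_lt_trans _ _ (F psi
      - delta s * al * (1 - l * (delta s * al)) * norm2 (grad F psi) ^+ 2)).
    apply: descent => //; [by rewrite mulr_ge0 ?ltW| |exact: ltW].
    move=> t t01; rewrite (le_trans (lip _ _ (in_ball _ t01) _))//.
      by have := in_ball 0; rewrite mul0r scale0r subr0; apply;
         rewrite lexx ler01.
    by rewrite addrAC subrr sub0r norm2N.
  (* Strict decrease needs a nonzero gradient, which the lower threshold ensures before the stop. *)
  have g2 : 0 < norm2 (grad F psi) ^+ 2 by rewrite exprn_gt0// (lt_trans low0).
  rewrite ltrD2l ltrN2 ltr_pM2r// -mulrA mulrC ltr_pM2l ?mulr_gt0//.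
  by rewrite ltrBrDr addrC -ltrBrDr [l * _]mulrC.
(* The step from [x] already passes the acceptance bound strictly; later steps only lower [F]. *)
have {}decr j : (j < jstop F s)%N -> F (inner F s j.+1).1
    < F x - rho * delta s * alpha F s x (lip0 s) * norm2 (grad F x) ^+ 2.
  elim: j => [|j IHj] jlt; first by have := decr _ jlt; rewrite /= sx.
  apply: lt_trans (IHj (ltnW jlt)); apply: lt_le_trans (decr _ jlt) _.
  rewrite gerBl mulr_ge0 ?sqr_ge0// mulr_ge0 ?(ltW (alpha_gt0 _ _ _))//.
    by rewrite mulr_ge0 ?ltW.
  exact: inner_lip_ge0.
have : (0 < jstop F s)%N by rewrite jstop_gt0// slow supp sx lowg.
rewrite /accepts sx; case: jstop decr => // J decr _; exact: decr.
Qed.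

Lemma exists_decrease (rho dbar delta0 : R) (x : 'rV[R]_n) :
  locally_lipschitz (grad F) -> 0 < rho < 1 -> 0 < dbar -> 0 < delta0 ->
  grad F x != 0 ->
  exists k, F (iterate F rho dbar delta0 x k) < F x.
Proof.
move=> lipF /andP[rho0 rho1] dbar0 delta0_gt0 gx0.
pose S k := iter k (step F rho dbar) (init F delta0 x).
have adm k : admissible (S k) by exact: iter_step_admissible.
set low := norm2 (grad F x) / Num.sqrt 2.
set upp := Num.sqrt 10 * norm2 (grad F x).
have g_gt0 : 0 < norm2 (grad F x) by rewrite norm2_gt0.
(* Puts the initial gradient norm strictly between the two thresholds. *)
have sqrt_gt1 m : 1 < m -> 1 < Num.sqrt m :> R.
  by move=> m1; rewrite -[ltLHS]sqrtr1 ltr_sqrt// (lt_trans ltr01).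
have low_itv : 0 < low < norm2 (grad F x).
  have sqrt2_gt1 : 1 < Num.sqrt 2 :> R by rewrite sqrt_gt1 ?ltr1n.
  have sqrt2_gt0 := lt_trans ltr01 sqrt2_gt1.
  by rewrite /low divr_gt0//= ltr_pdivrMr// ltr_pMr.
have upp_gt : norm2 (grad F x) < upp by rewrite ltr_pMl// sqrt_gt1// ltr1n.
have [d d0 acc] := accepts_small_delta lipF rho0 rho1 low_itv upp_gt.
apply: contrapT => never.
(* An acceptance at [x] would produce a value below [F x], so every iteration rejects and halves
   [delta]. *)
have rejects k : [/\ theta (S k) = x, delta (S k) = delta0 / 2 ^+ k,
    tau_low (S k) = low & tau_upp (S k) = upp].
  elim: k => [|k [Sx Sd Slow Supp]]; first by rewrite /= expr0 divr1.
  have gSk : grad F (theta (S k)) != 0 by rewrite Sx.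
  have rej : ~~ accepts rho (S k).
    apply/negP => acck; apply: never; exists k.+1; rewrite -{2}Sx.
    exact: step_accept_lt.
  have [-> -> -> ->] := step_reject dbar gSk rej.
  by split => //; rewrite Sd exprS invfM mulrCA.
(* With this [k], [delta0 / d < 2 ^+ k], so [delta (S k)] is below [d]. *)
pose k := Num.bound (delta0 / d).
have [Sx Sd Slow Supp] := rejects k.
apply: never; exists k.+1; rewrite -{2}Sx.
apply: step_accept_lt rho0 (adm k) _ _; rewrite ?Sx//.
apply: acc Sx Slow Supp (adm k) _.
by rewrite Sd ltr_pdivrMr ?exprn_gt0// mulrC -ltr_pdivrMr// upper_nthrootP.
Qed.

End Algorithm.

Theorem corollary1 (R : realType) (n : nat) (F : 'rV[R]_n -> R)
    (rho dbar delta0 : R) (theta0 : 'rV[R]_n)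
    (F_diff : forall x, differentiable F x)
    (gradF_lip : locally_lipschitz (grad F))
    (rho_itv : 0 < rho < 1) (dbar_gt0 : 0 < dbar)
    (delta0_itv : 0 < delta0 <= dbar) :
  (forall T : nat, F (iterate F rho dbar delta0 theta0 T) <= F theta0) /\
  (grad F theta0 != 0 ->
   exists Tstar : nat, forall t : nat, (Tstar <= t)%N ->
     F (iterate F rho dbar delta0 theta0 t) < F theta0).
Proof.
have /andP[delta0_gt0 _] := delta0_itv; have /andP[rho_gt0 _] := rho_itv.
have mono k m : F (iterate F rho dbar delta0 theta0 (m + k))
    <= F (iterate F rho dbar delta0 theta0 k).
  by elim: m => // m; apply: le_trans; apply: step_le rho_gt0 _;
     exact: iter_step_admissible.
split=> [T|g0]; first by have := mono 0%N T; rewrite addn0.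
have [k Fk] := exists_decrease F_diff gradF_lip rho_itv dbar_gt0
  delta0_gt0 g0.
(* Monotonicity carries the single decrease to all later iterates. *)
by exists k => t kt; rewrite -(subnK kt) (le_lt_trans (mono _ _)).
Qed.
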